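(* Let $G$ be a graph with $V(G)=V_1\cup\dots\cup V_t$, where $G[V_i]$ is a retract of $G$ for every $i\in[t]$, and let $k_1,\dots,k_t$ be nonnegative integers with $k=\sum_{i\in[t]}k_i$. Then $\mathrm{capt}_k(G)\le \max_{i\in[t]}\mathrm{capt}_{k_i}(G[V_i])$, where by convention $\mathrm{capt}_{k_i}(G[V_i])=\infty$ if $k_i<c(G[V_i])$.
   Context: Graphs are finite, undirected and reflexive. A retract of $G$ is an induced subgraph $H$ with a graph homomorphism $G\to H$ restricting to the identity on $H$. The game of Cops and Robbers: cops choose starting vertices (round 0), then the robber; players alternate, cops (any subset) moving to adjacent vertices or staying put, then the robber moving or staying; cops win by occupying the robber's vertex. $c(G)$ is the least number of cops with a winning strategy. For $k\ge c(G)$, $\mathrm{capt}_k(G)$ is the minimum over $k$-cop strategies of the number of rounds (excluding round 0) until capture against an optimally evading robber. *)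

(* Defs.v *)
From mathcomp Require Import all_boot.
From mathcomp Require Import boolp.

Set Implicit Arguments.
Unset Strict Implicit.
Unset Printing Implicit Defensive.

(* Graphs may be empty. *)
Record graph := Graph {
  vertex :> finType;
  adj : rel vertex;
  adj_refl : reflexive adj;
  adj_sym : symmetric adj
}.

Definition induced_adj (G : graph) (V : {set G}) : rel {x : G | x \in V} :=
  fun x y => adj (val x) (val y).

Lemma induced_adj_refl (G : graph) (V : {set G}) : reflexive (@induced_adj G V).
Proof. by move=> x; exact: adj_refl. Qed.

Lemma induced_adj_sym (G : graph) (V : {set G}) : symmetric (@induced_adj G V).
Proof. by move=> x y; exact: adj_sym. Qed.

Definition induced (G : graph) (V : {set G}) : graph :=
  Graph (@induced_adj_refl G V) (@induced_adj_sym G V).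

Definition homomorphism (G H : graph) (f : G -> H) : Prop :=
  forall x y : G, adj x y -> adj (f x) (f y).

Definition is_retract (G : graph) (V : {set G}) : Prop :=
  exists2 r : G -> induced V,
    homomorphism r & forall x : induced V, r (val x) = x.

(* Natural numbers extended with infinity, represented by [None]. *)
Definition enat := option nat.
Notation infty := (@None nat).

Definition enat_le (a b : enat) : bool :=
  match a, b with
  | _, None => true
  | None, Some _ => false
  | Some m, Some n => m <= n
  end.

Definition enat_max (a b : enat) : enat := if enat_le a b then b else a.

(* The least element of a set of natural numbers; infinity if it is empty. *)
Definition enat_inf (P : nat -> Prop) : enat :=
  if pselect (exists n, `[< P n >]) is left exP then Some (ex_minn exP)
  else infty.

(* [cops s h] is the position of the cops after their move in round [size h],
   where [h] lists the robber's positions at the end of rounds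
   0, ..., (size h).-1; in particular [cops s [::]] is the initial placement.
   Legality is also required after histories that no robber can produce; this
   is no restriction, as the cops may always stay put. *)
Record strategy (G : graph) (k : nat) := Strategy {
  cops : seq G -> 'I_k -> G;
  cops_legal : forall (h : seq G) (x : G) (i : 'I_k),
    adj (cops h i) (cops (rcons h x) i)
}.

(* [R j] is the robber's position at the end of round [j]. Play formally goes
   on after a capture; only the first capture is relevant. *)
Definition robber_play (G : graph) (R : nat -> G) : Prop :=
  forall j, adj (R j) (R j.+1).

(* In round [j > 0] the robber is caught by the move of the cops when one of
   them reaches [R j.-1], and by his own move when [R j] is occupied. In round 0
   only the latter is possible, and the two conditions coincide. *)
Definition captured_in (G : graph) (k : nat) (s : strategy G k)
    (R : nat -> G) (j : nat) : Prop :=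
  exists i : 'I_k, cops s (mkseq R j) i = R j.-1 \/ cops s (mkseq R j) i = R j.

Definition winning (G : graph) (k : nat) (s : strategy G k) : Prop :=
  forall R : nat -> G, robber_play R -> exists j, captured_in s R j.

Lemma exists_winning (G : graph) :
  exists k, `[< exists s : strategy G k, winning s >].
Proof.
have legal (h : seq G) (x : G) (i : 'I_#|G|) :
  adj (enum_val i : G) (enum_val i) by exact: adj_refl.
exists #|G|; apply/asboolP; exists (Strategy legal) => R _.
by exists 0, (enum_rank (R 0)); right; rewrite /= enum_rankK.
Qed.

Definition cop_number (G : graph) : nat := ex_minn (exists_winning G).

Definition capture_time (G : graph) (k : nat) (s : strategy G k)
    (R : nat -> G) : enat :=
  enat_inf (captured_in s R).

(* The supremum, over all plays of the robber, of the capture time. *)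
Definition strategy_time (G : graph) (k : nat) (s : strategy G k) : enat :=
  enat_inf (fun n => forall R : nat -> G,
    robber_play R -> enat_le (capture_time s R) (Some n)).

Definition capt (k : nat) (G : graph) : enat :=
  if k < cop_number G then infty
  else enat_inf (fun n => exists s : strategy G k, strategy_time s = Some n).

(* Main.v *)
(** Team [i] plays a shortest capture on [V i] against the shadow of the robber
    under a retraction, and a cop who has caught the shadow keeps following it.
    A robber on the verge of capture may stay put, so a strategy which wins
    within [n] rounds brings a cop onto the robber (or shadow) already by the
    cops' move of round [n]. After that move in the maximal round, all shadows
    are occupied at once; the robber himself lies in some [V i], where he is
    his own shadow. *)

Require Import Defs.
From mathcomp Require Import all_boot.
From mathcomp Require Import boolp.

Set Implicit Arguments.
Unset Strict Implicit.
Unset Printing Implicit Defensive.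

Lemma enat_infP (P : nat -> Prop) (n : nat) : enat_inf P = Some n -> P n.
Proof.
rewrite /enat_inf; case: pselect => // exP [<-].
by case: ex_minnP => m /asboolP.
Qed.

Lemma enat_inf_leP (P : nat -> Prop) (n : nat) :
  enat_le (enat_inf P) (Some n) <-> exists2 m, m <= n & P m.
Proof.
split=> [|[m le_mn Pm]].
  by case E: (enat_inf P) => [m|] //= le_mn; exists m => //; apply: enat_infP.
rewrite /enat_inf; case: pselect => [exP|[]]; last by exists m; apply/asboolP.
case: ex_minnP => m' _ min_m' /=; apply: leq_trans le_mn.
by apply: min_m'; apply/asboolP.
Qed.

Lemma enat_le_bigmax (I : finType) (F : I -> enat) (i : I) :
  enat_le (F i) (\big[enat_max/Some 0]_j F j).
Proof.
have le_refl a : enat_le a a by case: a => /=.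
have le_trans b a c : enat_le a b -> enat_le b c -> enat_le a c.
  by case: a b c => [a|] [b|] [c|] //=; apply: leq_trans.
have le_maxl a b : enat_le a (enat_max a b).
  by rewrite /enat_max; case: ifP.
have le_maxr a b : enat_le b (enat_max a b).
  rewrite /enat_max; case: ifP => // /negbT.
  by case: a b => [a|] [b|] //=; rewrite -ltnNge => /ltnW.
have: i \in index_enum I by rewrite mem_index_enum.
elim: (index_enum I) => // j s IHs; rewrite inE big_cons.
case/orP=> [/eqP <- //|/IHs le_s]; exact: le_trans le_s (le_maxr _ _).
Qed.

Section Strategies.

Variables (G : graph) (k : nat).

Definition wins_within (s : strategy G k) (n : nat) : Prop :=
  forall R : nat -> G, robber_play R -> exists2 j, j <= n & captured_in s R j.

(** The nested infima collapse into one strategy with a uniform deadline; such a strategy is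
    winning, which rules out [k < cop_number G]. *)
Lemma capt_le_Some (n : nat) :
  enat_le (capt k G) (Some n) <-> exists s : strategy G k, wins_within s n.
Proof.
have time_leP (s : strategy G k) m :
    enat_le (strategy_time s) (Some m) <-> wins_within s m.
  split=> [/enat_inf_leP [j le_jm win] R /win/enat_inf_leP [i le_ij]|win].
    by exists i => //; apply: leq_trans le_jm.
  by apply/enat_inf_leP; exists m => // R /win ?; apply/enat_inf_leP.
split=> [|[s win]].
  rewrite /capt; case: ifP => // _ /enat_inf_leP [m le_mn [s time_s]].
  by exists s; apply/time_leP; rewrite time_s.
rewrite /capt ltnNge.
have -> /= : cop_number G <= k.
  rewrite /cop_number; case: ex_minnP => m _; apply.
  by apply/asboolP; exists s => R /win [j _ ?]; exists j.
(* [capt] is an infimum of exact strategy times, so the witness is the time [m] of [s] rather than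
   the bound [n]. *)
apply/enat_inf_leP; move/time_leP: win.
by case E: (strategy_time s) => [m|] //= le_mn; exists m => //; exists s.
Qed.

Lemma sorted_mkseq_play (R : nat -> G) (n : nat) :
  robber_play R -> sorted (@adj G) (mkseq R n).
Proof.
move=> playR; case: n => // n; apply/(sortedP (R 0)) => i.
rewrite size_mkseq => lt_in.
by rewrite !nth_mkseq ?(ltnW lt_in) //; apply: playR.
Qed.

(* Illegal robber moves are deleted from the history, so that rules which are
   legal only against genuine plays still give a [strategy]. *)
Lemma strategy_of_legal_histories (pos : seq G -> 'I_k -> G) :
  (forall h x i, sorted (@adj G) (rcons h x) ->
     adj (pos h i) (pos (rcons h x) i)) ->
  exists s : strategy G k,
    forall h, sorted (@adj G) h -> cops s h = pos h.
Proof.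
move=> legal.
pose step a x := if sorted (@adj G) (rcons a x) then rcons a x else a.
have clean_legal h x i :
    adj (pos (foldl step [::] h) i) (pos (foldl step [::] (rcons h x)) i).
  rewrite foldl_rcons {2}/step; case: ifP => [|_]; first exact: legal.
  exact: adj_refl.
exists (Strategy clean_legal) => h sorted_h /=; congr pos.
elim/last_ind: h sorted_h => // h x IHh sorted_hx.
rewrite foldl_rcons IHh /step ?sorted_hx //.
by move: sorted_hx; rewrite -cats1 => /cat_sorted2 [].
Qed.

(** Tested cop by cop, since only a cop who made a catch himself can start following. All indices
    stay below [size h], so [x0] is never read. *)
Definition has_caught (s : strategy G k) (h : seq G) (i : 'I_k) (x0 : G) :=
  [exists j : 'I_(size h),
     (cops s (take j h) i == nth x0 h j.-1) ||
     (cops s (take j h) i == nth x0 h j)].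

Definition follow (s : strategy G k) (h : seq G) (i : 'I_k) : G :=
  let p := cops s h i in if has_caught s h i p then last p h else p.

Lemma has_caughtP (s : strategy G k) (h : seq G) (i : 'I_k) (x0 : G) :
  reflect (exists2 j, j < size h &
             cops s (take j h) i = nth x0 h j.-1 \/
             cops s (take j h) i = nth x0 h j)
          (has_caught s h i x0).
Proof.
apply: (iffP existsP) => [[j /orP caught]|[j lt_j caught]].
  by exists j => //; case: caught => /eqP; [left | right].
by exists (Ordinal lt_j); case: caught => /= ->; rewrite eqxx ?orbT.
Qed.

Lemma has_caught_default (s : strategy G k) (h : seq G) (i : 'I_k) (x0 x1 : G) :
  has_caught s h i x0 = has_caught s h i x1.
Proof.
apply: eq_existsb => j.
by rewrite !(set_nth_default x1 x0) // (leq_ltn_trans (leq_pred j)).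
Qed.

(** The added round is round [size h], where the cops know only [h]. In round 0, [last x h] is [x],
    in accordance with [0.-1 = 0]. *)
Lemma has_caught_rcons (s : strategy G k) (h : seq G) (x : G) (i : 'I_k)
    (x0 : G) :
  has_caught s (rcons h x) i x0 =
  [|| has_caught s h i x0, cops s h i == last x h | cops s h i == x].
Proof.
have last_nth : nth x0 (rcons h x) (size h).-1 = last x h.
  by case: h => //= y h; rewrite -rcons_cons nth_rcons /= ltnS leqnn nth_last.
have take_h j : j <= size h -> take j (rcons h x) = take j h.
  by move=> le_jh; rewrite -cats1 takel_cat.
have nth_h j : j < size h -> nth x0 (rcons h x) j = nth x0 h j.
  by move=> lt_jh; rewrite nth_rcons lt_jh.
apply/has_caughtP/idP => [[j]|].
  rewrite size_rcons ltnS leq_eqVlt => /predU1P [->|lt_jh].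
    rewrite take_h // take_size last_nth nth_rcons ltnn eqxx.
    by case=> ->; rewrite eqxx ?orbT.
  rewrite take_h ?(ltnW lt_jh) // !nth_h ?(leq_ltn_trans (leq_pred j)) //.
  by move=> caught; apply/orP; left; apply/has_caughtP; exists j.
case/orP=> [/has_caughtP [j lt_jh caught]|caught].
  exists j; first by rewrite size_rcons ltnW.
  by rewrite take_h ?(ltnW lt_jh) // !nth_h ?(leq_ltn_trans (leq_pred j)).
exists (size h); first by rewrite size_rcons.
rewrite take_h // take_size last_nth nth_rcons ltnn eqxx.
by case/orP: caught => /eqP; [left | right].
Qed.

(** A follower retraces the robber's path one step behind. A cop who has just made his catch stands
    at an end of the robber's last step, so [x] is within reach. Before that he moves as in [s]. *)
Lemma follow_legal (s : strategy G k) (h : seq G) (x : G) (i : 'I_k) :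
  sorted (@adj G) (rcons h x) -> adj (follow s h i) (follow s (rcons h x) i).
Proof.
move=> sorted_hx; rewrite /follow has_caught_rcons last_rcons.
(* The two tests carry different defaults; once these agree, one case split settles both. *)
rewrite (has_caught_default _ _ _ _ (cops s h i)).
have adj_last y : h != [::] -> adj (last y h) x.
  by case: h sorted_hx => //= z h; rewrite rcons_path => /andP [].
case: ifP => [caught|_] /=.
  by apply: adj_last; case: h caught {sorted_hx} => // /existsP [[]].
case: ifP => [|_]; last exact: cops_legal.
case/orP=> /eqP ->; last exact: adj_refl.
case: h sorted_hx adj_last => [|y h] _ adj_last /=; first exact: adj_refl.
exact: (adj_last y).
Qed.

Lemma wins_within_follow (s : strategy G k) (n : nat) :
  wins_within s n ->
  exists s' : strategy G k, forall R, robber_play R ->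
    forall m, n <= m -> exists i, cops s' (mkseq R m) i = R m.-1.
Proof.
move=> win; have [s' s'E] := strategy_of_legal_histories (@follow_legal s).
exists s' => R playR m le_nm.
rewrite s'E ?sorted_mkseq_play //.
(* Against a robber who stays put in round [m], a capture in round [m] is made
   by the cops' move. *)
pose R' j := R (minn j m.-1).
have playR' : robber_play R'.
  move=> j; rewrite /R'; case: (ltnP j m.-1) => [lt_jm|le_mj].
    by rewrite (minn_idPl lt_jm); apply: playR.
  by rewrite (minn_idPr (leqW le_mj)); apply: adj_refl.
have R'E j : j < m -> R' j = R j.
  case: m le_nm @R' playR' => // m' _ R' _.
  by rewrite ltnS /R' => /minn_idPl ->.
have mkseqE j : j <= m -> mkseq R' j = mkseq R j.
  move=> le_jm; apply/eq_in_map => x; rewrite mem_iota /= => lt_xj.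
  exact/R'E/leq_trans/le_jm.
have [j le_jn [i caught]] := win R' playR'.
have le_jm := leq_trans le_jn le_nm.
(* A follower stands on the last entry of [mkseq R m], which is [R m.-1]. *)
exists i; rewrite /follow; case: ifP => [/has_caughtP [l]|not_caught].
  rewrite size_mkseq => lt_lm _.
  by rewrite -nth_last size_mkseq nth_mkseq // prednK //
    (leq_ltn_trans _ lt_lm).
move: caught; rewrite mkseqE //.
(* In round [m] both forms of capture name [R m.-1]; a catch in an earlier round would have made the
   cop a follower. *)
move: le_jm; rewrite leq_eqVlt => /predU1P [->|lt_jm].
  by rewrite /R' minnn (minn_idPr (leq_pred m)) => -[].
rewrite !R'E ?(leq_ltn_trans (leq_pred j)) // => caught.
case/negP: (negbT not_caught); apply/has_caughtP.
exists j; first by rewrite size_mkseq.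
rewrite !nth_mkseq ?(leq_ltn_trans (leq_pred j)) //.
by rewrite /mkseq -map_take take_iota (minn_idPl (ltnW lt_jm)).
Qed.

End Strategies.

Theorem theorem2p5 (G : graph) (t : nat) (V : 'I_t -> {set G})
    (ks : 'I_t -> nat) (k : nat)
    (hV : \bigcup_(i < t) V i = [set: G])
    (hretract : forall i : 'I_t, is_retract (V i))
    (hk : k = \sum_(i < t) ks i) :
  enat_le (capt k G)
    (\big[enat_max/Some 0]_(i < t) capt (ks i) (induced (V i))).
Proof.
case E: (\big[_/_]_(i < t) _) => [n|]; last by case: (capt k G).
have team i : exists s : strategy (induced (V i)) (ks i),
    forall R, robber_play R -> exists c, cops s (mkseq R n) c = R n.-1.
  have := enat_le_bigmax (fun i => capt (ks i) (induced (V i))) i.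
  rewrite E => /capt_le_Some [s /wins_within_follow [s' s'P]].
  by exists s' => R playR; apply: s'P.
pose s i := projT1 (cid (team i)).
have sP i : forall R, robber_play R ->
    exists c, cops (s i) (mkseq R n) c = R n.-1.
  exact: projT2 (cid (team i)).
have [r r_hom r_id] : exists2 r : forall i, G -> induced (V i),
    forall i, homomorphism (r i) & forall i x, r i (val x) = x.
  exists (fun i => s2val (cid2 (hretract i))) => i.
    exact: s2valP (cid2 (hretract i)).
  exact: s2valP' (cid2 (hretract i)).
(* The [k] cops are numbered as pairs of a team and a member of it. *)
have card_k : #|{: {i : 'I_t & 'I_(ks i)}}| = k.
  rewrite card_tagged sumnE big_map hk big_enum.
  by apply: eq_bigr => i _; rewrite card_ord.
pose idx (c : 'I_k) : {i : 'I_t & 'I_(ks i)} :=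
  enum_val (cast_ord (esym card_k) c).
pose pos h c := val (cops (s (tag (idx c))) (map (r _) h) (tagged (idx c))).
have pos_legal h x c : adj (pos h c) (pos (rcons h x) c).
  rewrite /pos map_rcons.
  exact: (cops_legal (s (tag (idx c))) (map (r _) h) (r _ x) (tagged (idx c))).
apply/capt_le_Some; exists (Strategy pos_legal) => R playR; exists n => //.
(* The successful team depends on the play: its part contains [R n.-1], the position to be hit in
   round [n]. *)
have: R n.-1 \in \bigcup_(i < t) V i by rewrite hV inE.
case/bigcupP=> i _ R_Vi.
(* The shadow moves legally because [r i] is a homomorphism. *)
have [c sc] := sP i (r i \o R) (fun j => r_hom i _ _ (playR j)).
exists (cast_ord card_k (enum_rank (Tagged (fun i => 'I_(ks i)) c))); left.
rewrite /= /pos /idx cast_ordK enum_rankK /= /mkseq -map_comp.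
(* The cop is on the shadow of [R n.-1], a vertex that [r i] fixes. *)
by rewrite [cops _ _ _]sc /= (r_id i (Sub (R n.-1) R_Vi)).
Qed.
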